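(* Let $d\ge 2$ and let $X$ be an $\mathbb{R}^d$-valued random vector whose distribution is not supported on any line. Let $u\in\mathbb{S}^{d-1}$ and $0<\alpha<1$, and let $q_X(\alpha u)$ denote the geometric quantile of $X$ with index vector $\alpha u$. 1. Let $k_\alpha>0$ be such that $\mathbb{P}(\|X\|>k_\alpha)<(1-\alpha)/2$. Then $$\|q_X(\alpha u)\|\le \frac{2\,k_\alpha\,\mathbb{P}(\|X\|\le k_\alpha)}{1-\alpha-2\,\mathbb{P}(\|X\|>k_\alpha)}.$$ 2. If $\mathbb{E}\|X\|<\infty$, then $$\|q_X(\alpha u)\|\le \frac{2\,\mathbb{E}\|X\|}{1-\alpha}.$$
   Context: $\mathbb{S}^{d-1}$ is the Euclidean unit sphere in $\mathbb{R}^d$; $\|\cdot\|$ and $\langle\cdot,\cdot\rangle$ are the Euclidean norm and inner product. Geometric quantile: for an $\mathbb{R}^d$-valued random vector $X$ ($d>1$) whose distribution is not supported on any line, $u\in\mathbb{S}^{d-1}$ and $0\le\alpha<1$, the geometric quantile $q_X(\alpha u)$ is the (existing and unique) minimiser $$q_X(\alpha u)=\operatorname*{arg\,min}_{q\in\mathbb{R}^d}\Big(\mathbb{E}\big[\|X-q\|-\|X\|\big]-\langle\alpha u,q\rangle\Big).$$ *)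

(* Defs.v *)
From HB Require Import structures.
From mathcomp Require Import all_boot all_order all_algebra.
From mathcomp Require Import all_classical all_reals all_analysis.

Set Implicit Arguments.
Unset Strict Implicit.
Unset Printing Implicit Defensive.

Import Order.TTheory GRing.Theory Num.Theory.
Import numFieldNormedType.Exports.

Local Open Scope classical_set_scope.
Local Open Scope ring_scope.

(* R^d with its Borel sigma-algebra. The topology of 'rV[R]_d comes from the
   sup norm, so its open sets are the Euclidean ones. *)
Notation borel_rV R d := (g_sigma_algebraType (@open 'rV[R]_d)).

Definition dotp (R : realType) (d : nat) (u v : 'rV[R]_d) : R :=
  \sum_(i < d) u ord0 i * v ord0 i.

(* The Euclidean norm; the library's `|v| on 'rV[R]_d is the sup norm. *)
Definition enorm (R : realType) (d : nat) (v : 'rV[R]_d) : R :=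
  Num.sqrt (dotp v v).

Definition line (R : realType) (d : nat) (a v : 'rV[R]_d) : set 'rV[R]_d :=
  [set a + t *: v | t in [set: R]].

Definition supported_on_line (R : realType) (d : nat)
    (mu : set 'rV[R]_d -> \bar R) : Prop :=
  exists a v : 'rV[R]_d, v != 0 /\ mu (line a v) = 1%E.

Section GeometricQuantile.
Context (disp : measure_display) (T : measurableType disp) (R : realType)
  (P : probability T R) (d : nat).

(* The integrand is bounded by enorm q in absolute value, so the expectation
   is finite without any moment assumption on X. *)
Definition quantile_objective (X : T -> 'rV[R]_d) (w q : 'rV[R]_d) : \bar R :=
  ('E_P[(fun t => (enorm (X t - q) - enorm (X t))%R)] - (dotp w q)%:E)%E.

Definition is_geometric_quantile (X : T -> 'rV[R]_d) (w q : 'rV[R]_d) : Prop :=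
  forall q' : 'rV[R]_d,
    (quantile_objective X w q <= quantile_objective X w q')%E.

End GeometricQuantile.

(* Main.v *)
(* Testing the minimality of q against 0 gives E[|X - q| - |X|] <= alpha |q|.
   The integrand is at least |q| - 2 |X| and at least - |q|. Taking expectations
   of the first bound gives part 2; using the first bound where |X| <= k and the
   second elsewhere gives part 1. *)
Require Import Defs.
From HB Require Import structures.
From mathcomp Require Import all_boot all_order all_algebra.
From mathcomp Require Import all_classical all_reals all_analysis.
From mathcomp Require Import measurable_realfun ring lra.

Set Implicit Arguments.
Unset Strict Implicit.
Unset Printing Implicit Defensive.

Import Order.TTheory GRing.Theory Num.Theory.
Import numFieldNormedType.Exports.

Local Open Scope classical_set_scope.
Local Open Scope ring_scope.

Lemma dotpC (R : realType) (d : nat) (u v : 'rV[R]_d) : dotp u v = dotp v u.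
Proof. by apply: eq_bigr => i _; rewrite mulrC. Qed.

Lemma dotpDl (R : realType) (d : nat) (u v w : 'rV[R]_d) :
  dotp (u + v) w = dotp u w + dotp v w.
Proof. by rewrite -big_split; apply: eq_bigr => i _; rewrite mxE mulrDl. Qed.

Lemma dotpZl (R : realType) (d : nat) (a : R) (u v : 'rV[R]_d) :
  dotp (a *: u) v = a * dotp u v.
Proof. by rewrite mulr_sumr; apply: eq_bigr => i _; rewrite mxE mulrA. Qed.

Lemma dotp_ge0 (R : realType) (d : nat) (v : 'rV[R]_d) : 0 <= dotp v v.
Proof. by apply: sumr_ge0 => i _; rewrite -expr2 sqr_ge0. Qed.

Lemma enorm_ge0 (R : realType) (d : nat) (v : 'rV[R]_d) : 0 <= enorm v.
Proof. exact: sqrtr_ge0. Qed.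

Lemma enorm_sqr (R : realType) (d : nat) (v : 'rV[R]_d) :
  enorm v ^+ 2 = dotp v v.
Proof. by rewrite sqr_sqrtr ?dotp_ge0. Qed.

(** Feeds both the Cauchy-Schwarz and the triangle inequality below. *)
Lemma dotp_lincomb (R : realType) (d : nat) (a b : R) (u v : 'rV[R]_d) :
  dotp (a *: u + b *: v) (a *: u + b *: v) =
  a ^+ 2 * dotp u u + 2 * a * b * dotp u v + b ^+ 2 * dotp v v.
Proof.
rewrite dotpDl !dotpZl [dotp u (_ + _)]dotpC [dotp v (_ + _)]dotpC.
by rewrite !dotpDl !dotpZl [dotp v u]dotpC; ring.
Qed.

Lemma dotp0r (R : realType) (d : nat) (u : 'rV[R]_d) : dotp u 0 = 0.
Proof. by rewrite dotpC -(scale0r 0) dotpZl mul0r. Qed.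

Lemma enorm0_eq0 (R : realType) (d : nat) (v : 'rV[R]_d) :
  enorm v = 0 -> v = 0.
Proof.
move=> v0; have /psumr_eq0P v0P : dotp v v = 0 by rewrite -enorm_sqr v0 expr0n.
apply/rowP => i; rewrite mxE; apply/eqP.
by rewrite -sqrf_eq0 expr2 v0P // => j _; rewrite -expr2 sqr_ge0.
Qed.

(** Cauchy-Schwarz. The degenerate vectors are treated first because the main case divides by
    [enorm u * enorm v]. *)
Lemma dotp_le_enorm (R : realType) (d : nat) (u v : 'rV[R]_d) :
  dotp u v <= enorm u * enorm v.
Proof.
have [/enorm0_eq0 ->|u0] := eqVneq (enorm u) 0.
  by rewrite dotpC dotp0r mulr_ge0 ?enorm_ge0.
have [/enorm0_eq0 ->|v0] := eqVneq (enorm v) 0.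
  by rewrite dotp0r mulr_ge0 ?enorm_ge0.
(* With these weights the expanded square is [2 * (enorm u * enorm v)] times
   [enorm u * enorm v - dotp u v]. *)
have := dotp_ge0 (enorm v *: u + (- enorm u) *: v).
rewrite dotp_lincomb -!enorm_sqr => h.
have uv_gt0 : 0 < enorm u * enorm v.
  by rewrite mulr_gt0 // lt_neqAle eq_sym enorm_ge0 andbT.
rewrite -subr_ge0 -(pmulr_rge0 _ uv_gt0); lra.
Qed.

(** After squaring, Cauchy-Schwarz bounds the cross term. *)
Lemma enormD (R : realType) (d : nat) (u v : 'rV[R]_d) :
  enorm (u + v) <= enorm u + enorm v.
Proof.
rewrite -(@ler_pXn2r _ 2) ?nnegrE ?addr_ge0 ?enorm_ge0 // enorm_sqr.
have := dotp_lincomb 1 1 u v; rewrite !scale1r -!enorm_sqr => ->.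
by have := dotp_le_enorm u v; nra.
Qed.

Lemma enormN (R : realType) (d : nat) (v : 'rV[R]_d) : enorm (- v) = enorm v.
Proof. by rewrite /enorm -scaleN1r dotpZl dotpC dotpZl mulrA mulrNN !mul1r. Qed.

Lemma enormB (R : realType) (d : nat) (u v : 'rV[R]_d) :
  enorm (u - v) <= enorm u + enorm v.
Proof. by rewrite -(enormN v) enormD. Qed.

(** Triangle inequality for [v = u - (u - v)]. With [u := X t] and [v := q] it bounds the integrand
    below by [enorm q - 2 * enorm (X t)]. *)
Lemma enormB_ge (R : realType) (d : nat) (u v : 'rV[R]_d) :
  enorm v - enorm u <= enorm (u - v).
Proof.
rewrite lerBlDl -(enormN (u - v)).
by apply: le_trans (enormD _ _); rewrite opprB addrCA subrr addr0.
Qed.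

(** Serves twice: it makes the integrand integrable, and it gives the lower bound [- enorm q] where
    [X] is large. *)
Lemma enormB_sub_bounded (R : realType) (d : nat) (q x : 'rV[R]_d) :
  `|enorm (x - q) - enorm x| <= enorm q.
Proof.
rewrite ler_norml; apply/andP; split; last by have := enormB x q; lra.
by have := enormD (x - q) q; rewrite subrK; lra.
Qed.

(** Open intervals generate the Borel sets of the line, and their preimages under a continuous
    coordinate are open. *)
Lemma measurable_coord (R : realType) (d : nat) (i : 'I_d) :
  measurable_fun [set: borel_rV R d] (fun v : borel_rV R d => v ord0 i).
Proof.
apply: (measurability _ (RGenOpens.measurableE R)).
move=> _ [_ [a [b ->] <-]]; rewrite setTI.
apply: sub_sigma_algebra; apply: open_comp; last exact: interval_open.
by move=> v _; exact: coord_continuous.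
Qed.

Lemma measurable_enormB (R : realType) (d : nat) (q : 'rV[R]_d) :
  measurable_fun [set: borel_rV R d] (fun v : borel_rV R d => enorm (v - q)).
Proof.
apply: (measurableT_comp
  (continuous_measurable_fun (@sqrt_continuous R))).
apply: measurable_sum => i.
have m : measurable_fun [set: borel_rV R d]
    (fun v : borel_rV R d => (v - q) ord0 i).
  under eq_fun do rewrite !mxE.
  exact: (measurable_funB (measurable_coord i) (measurable_cst _)).
exact: (measurable_funM m m).
Qed.

Section Bounds.
Context (R : realType) (disp : measure_display) (T : measurableType disp)
  (P : probability T R) (d : nat) (X : {RV P >-> borel_rV R d}).

Lemma measurable_enormB_RV (q : 'rV[R]_d) :
  measurable_fun [set: T] (fun t => enorm (X t - q)).
Proof. exact: (measurableT_comp (measurable_enormB q)). Qed.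

Lemma measurable_enorm_RV : measurable_fun [set: T] (fun t => enorm (X t)).
Proof. by have := measurable_enormB_RV 0; under eq_fun do rewrite subr0. Qed.

Lemma Lfun1_enormB_sub (q : 'rV[R]_d) :
  (fun t => enorm (X t - q) - enorm (X t)) \in Lfun P 1.
Proof.
apply/Lfun1_integrable.
apply: (le_integrable measurableT _ _
  (finite_measure_integrable_cst P (enorm q) measurableT)) => /=.
  apply/measurable_EFinP; apply: measurable_funB.
    exact: measurable_enormB_RV.
  exact: measurable_enorm_RV.
move=> t _; rewrite lee_fin (ger0_norm (enorm_ge0 _)).
exact: enormB_sub_bounded.
Qed.

Lemma Lfun1_scale (c : R) (f : T -> R) :
  f \in Lfun P 1 -> c \o* f \in Lfun P 1.
Proof.
move=> /Lfun1_integrable /(integrableZl measurableT c) fi.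
apply/Lfun1_integrable; apply: eq_integrable fi => // t _ /=.
(* [c \o* f] multiplies by [c] on the right, hence the commutation. *)
by rewrite -EFinM mulrC.
Qed.

Lemma le_expectation (f g : T -> R) : f \in Lfun P 1 -> g \in Lfun P 1 ->
  (forall t, f t <= g t) -> ('E_P[f] <= 'E_P[g])%E.
Proof.
move=> /Lfun1_integrable fi /Lfun1_integrable gi fg; rewrite unlock.
by apply: le_integral => // t _; rewrite lee_fin.
Qed.

(** The objective vanishes at [0], so the expectation is at most [dotp (alpha *: u) q];
    Cauchy-Schwarz with [enorm u = 1] concludes. *)
Lemma geometric_quantile_expectation_le (u q : 'rV[R]_d) (alpha : R) :
  enorm u = 1 -> 0 <= alpha -> is_geometric_quantile P X (alpha *: u) q ->
  ('E_P[fun t => (enorm (X t - q) - enorm (X t))%R] <= (alpha * enorm q)%:E)%E.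
Proof.
move=> u1 a0 /(_ 0); rewrite /quantile_objective dotp0r sube0.
under [in leRHS]eq_fun do rewrite subr0 subrr.
rewrite expectation_cst sube_le0 => /le_trans; apply.
rewrite lee_fin dotpZl ler_wpM2l //.
by rewrite (le_trans (dotp_le_enorm _ _)) // u1 mul1r.
Qed.

End Bounds.

Theorem theorem3p1 (R : realType) (disp : measure_display)
    (T : measurableType disp) (P : probability T R)
    (d : nat) (hd : (2 <= d)%N)
    (X : {RV P >-> borel_rV R d})
    (hX : ~ supported_on_line (distribution P X))
    (u : 'rV[R]_d) (hu : enorm u = 1)
    (alpha : R) (halpha0 : 0 < alpha) (halpha1 : alpha < 1)
    (q : 'rV[R]_d) (hq : is_geometric_quantile P X (alpha *: u) q) :
  (forall k : R, 0 < k ->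
     (P [set t | (k < enorm (X t))%R] < ((1 - alpha) / 2)%:E)%E ->
     enorm q <=
       2 * k * fine (P [set t | (enorm (X t) <= k)%R]) /
       (1 - alpha - 2 * fine (P [set t | (k < enorm (X t))%R]))) /\
  (('E_P[(fun t => enorm (X t))] < +oo)%E ->
     enorm q <= 2 * fine 'E_P[(fun t => enorm (X t))] / (1 - alpha)).
Proof.
have hE := geometric_quantile_expectation_le hu (ltW halpha0) hq.
have q0 := enorm_ge0 q.
have mX := measurable_enorm_RV X.
have Ld := Lfun1_enormB_sub X q.
have cL (c : R) : cst c \in Lfun P 1.
  exact/Lfun1_integrable/finite_measure_integrable_cst.
split.
- move=> k k0 hk.
  set A := [set t | enorm (X t) <= k].
  have mA : measurable A.
    by rewrite -[A]setTI; exact: measurable_fun_le.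
  have AC : [set t | k < enorm (X t)] = ~` A.
    by apply/seteqP; split=> t /=; rewrite ltNge => /negP.
  have PA : P A = (fine (P A))%:E by rewrite fineK // fin_num_measure.
  (* In terms of [p], the probability of [A], the hypothesis reads [1 - p < (1 - alpha) / 2], which
     says that the denominator [1 - alpha - 2 * (1 - p)] is positive. *)
  move: hk; rewrite AC probability_setC // PA -EFinB lte_fin /=.
  set p := fine (P A) => hk.
  have iL : (\1_A : T -> R) \in Lfun P 1.
    exact/Lfun1_integrable/integrable_indic.
  (* [c] is the gap between the two lower bounds, so that [g] equals [enorm q - 2 * k] on [A] and
     [- enorm q] off [A]. *)
  pose c := 2 * enorm q - 2 * k.
  have ciL := Lfun1_scale c iL.
  pose g : T -> R := cst (- enorm q) \+ c \o* \1_A.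
  have : ('E_P[g] <= (alpha * enorm q)%:E)%E.
    apply: le_trans hE; apply: le_expectation => //; first exact: rpredD.
    move=> t; rewrite /g /= indicE.
    case: (boolP (t \in A)) => [/set_mem tA|_] /=.
      by have := enormB_ge (X t) q; rewrite /c; move: tA; rewrite /A /=; lra.
    by have := enormB_sub_bounded q (X t); rewrite ler_norml; lra.
  rewrite expectationD // expectation_cst expectationZl // expectation_indic //.
  rewrite PA -/p -EFinM -EFinD lee_fin /c => h.
  (* [h] rearranges to [enorm q * (2 * p - 1 - alpha) <= 2 * k * p]. *)
  by rewrite ler_pdivlMr; lra.
- move=> hfin.
  (* The norm is its own absolute value, so a finite expectation already means integrability. *)
  have iX : (fun t => enorm (X t)) \in Lfun P 1.
    apply/Lfun1_integrable/integrableP; split; first exact/measurable_EFinP.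
    move: hfin; rewrite unlock => hfin.
    by under eq_integral => t _
      do rewrite /= (ger0_norm (enorm_ge0 (X t))).
  have iX2 := Lfun1_scale 2 iX.
  pose g : T -> R := cst (enorm q) \- 2 \o* (fun t => enorm (X t)).
  have : ('E_P[g] <= (alpha * enorm q)%:E)%E.
    apply: le_trans hE; apply: le_expectation => //; first exact: rpredB.
    by move=> t; rewrite /g /=; have := enormB_ge (X t) q; lra.
  rewrite expectationB // expectation_cst expectationZl //.
  rewrite -(fineK (expectation_fin_num iX)) /= -EFinD lee_fin => h.
  (* Here [h] bounds [enorm q] minus twice the mean norm by [alpha * enorm q], and [1 - alpha] is
     positive. *)
  by rewrite ler_pdivlMr; lra.
Qed.
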